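(* Let $\Gamma=(V,E)$ be a finite simple graph on $V=\{1,\dots,n\}$ with clique number $\omega$, and let $\{T_j\}_{j=1}^n$ be a $\Gamma$-family on a Hilbert space $\mathcal{H}$ satisfying the weak Brehmer's condition. For $0\le r<1$ define the Cauchy transform $C_{r,T}:\mathcal{H}\to\ell^2(A_\Gamma^+)\otimes\mathcal{H}$ by $C_{r,T}h=\sum_{p\in A_\Gamma^+}\delta_p\otimes r^{|p|}T_p^*h$. Then $C_{r,T}$ is a well-defined bounded operator for every $0\le r<1$, and for each $h\in\mathcal{H}$, \[\|C_{r,T}h\|^2\leq\frac{1}{(1-r^2)^{\omega}}\|h\|^2.\]
   Context: $A_\Gamma^+=\langle e_1,\dots,e_n : e_ie_j=e_je_i \text{ if } ij\in E\rangle$ is the right-angled Artin monoid; $|p|$ is the number of generators in any expression of $p$ ($|1|=0$). $\{\delta_p:p\in A_\Gamma^+\}$ is the canonical orthonormal basis of $\ell^2(A_\Gamma^+)$. A $\Gamma$-family is a family of contractions $T_1,\dots,T_n$ on $\mathcal{H}$ with $T_iT_j=T_jT_i$ whenever $ij\in E$; it defines a unital representation $p\mapsto T_p$ with $T_{e_i}=T_i$. For a finite $U\subset A_\Gamma^+$, $\vee U=\infty$ if $\bigcap_{p\in U}pA_\Gamma^+=\emptyset$, otherwise $\vee U$ is the unique $r$ with $\bigcap_{p\in U}pA_\Gamma^+=rA_\Gamma^+$ ($\vee\emptyset=1$); $T_{\vee U}:=0$ if $\vee U=\infty$. For a set $U$ of generators, $\vee U<\infty$ iff the vertices form a clique, and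 then $\vee U=\prod_{e_i\in U}e_i$. The complement graph $\Gamma^c$ has vertex set $V$ and edges $\{ij:i\ne j,\ ij\notin E\}$. Weak Brehmer's condition: for each vertex set $V_i$ of a connected component of $\Gamma^c$, with $\Gamma_i=\Gamma|_{V_i}$, and each clique $W$ of $\Gamma_i$ (including $\emptyset$), with $N_{\Gamma_i}(W)=\{e_j: j\in V_i,\ jk\in E\ \forall k\in W\}$, one has $\sum_{U\subseteq N_{\Gamma_i}(W)}(-1)^{|U|}T_{\vee U}T_{\vee U}^*\ge0$. *)

(* Defs.v *)
(* mathcomp + reals (realType) + real-closed complex R[i]. *)
From HB Require Import structures.
From mathcomp Require Import all_boot all_order all_algebra.
From mathcomp Require Import reals complex.
From Stdlib Require Import Relations.
Set Implicit Arguments. Unset Strict Implicit. Unset Printing Implicit Defensive.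
Import Order.TTheory GRing.Theory Num.Theory.
Local Open Scope ring_scope.

(* ---------- complex Hilbert spaces ---------- *)

(* inner product, linear in the first variable, conjugate symmetric,
   positive definite *)
Definition is_inner_product (R : realType) (H : lmodType R[i])
    (inner : H -> H -> R[i]) : Prop :=
  [/\ (forall (a : R[i]) (x y z : H),
          inner (a *: x + y) z = a * inner x z + inner y z),
      (forall x y : H, inner y x = (inner x y)^*),
      (forall x : H, 0 <= inner x x)
    & (forall x : H, inner x x = 0 -> x = 0)].

(* completeness for the norm ||x|| = sqrt <x,x>  (squared distances used) *)
Definition inner_complete (R : realType) (H : lmodType R[i])
    (inner : H -> H -> R[i]) : Prop :=
  forall u : nat -> H,
    (forall eps : R, 0 < eps -> exists N, forall m k, (N <= m)%N -> (N <= k)%N ->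
        inner (u m - u k) (u m - u k) < (eps%:C)%C) ->
    exists x : H, forall eps : R, 0 < eps -> exists N, forall m, (N <= m)%N ->
        inner (u m - x) (u m - x) < (eps%:C)%C.

(* ---------- the graph Gamma on 'I_n ---------- *)

(* complement graph Gamma^c *)
Definition compl_rel (n : nat) (E : rel 'I_n) : rel 'I_n :=
  fun i j => (i != j) && ~~ E i j.

(* vertex set of the connected component of Gamma^c containing x *)
Definition compl_component (n : nat) (E : rel 'I_n) (x : 'I_n) : {set 'I_n} :=
  [set y | connect (compl_rel E) x y].

Definition is_clique (n : nat) (E : rel 'I_n) (S : {set 'I_n}) : bool :=
  [forall i in S, forall j in S, (i != j) ==> E i j].

(* clique number omega *)
Definition clique_number (n : nat) (E : rel 'I_n) : nat :=
  \max_(S : {set 'I_n} | is_clique E S) #|S|.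

(* N_{Gamma_i}(W) for Gamma_i = Gamma restricted to Vi *)
Definition nbhd (n : nat) (E : rel 'I_n) (Vi W : {set 'I_n}) : {set 'I_n} :=
  [set j in Vi | [forall k in W, E j k]].

(* ---------- the right-angled Artin monoid A_Gamma^+ ---------- *)

(* elements of A_Gamma^+ are words over the generators e_i (i : 'I_n)
   modulo the congruence generated by e_a e_b = e_b e_a for ab in E *)
Inductive word_step (n : nat) (E : rel 'I_n) : seq 'I_n -> seq 'I_n -> Prop :=
  | ws_swap (u v : seq 'I_n) (a b : 'I_n) :
      E a b -> word_step E (u ++ a :: b :: v) (u ++ b :: a :: v).

Definition word_equiv (n : nat) (E : rel 'I_n) : relation (seq 'I_n) :=
  clos_refl_trans (seq 'I_n) (word_step E).

(* ---------- operators associated with words ---------- *)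

(* T_w = T_{w_1} T_{w_2} ... T_{w_k} for w = e_{w_1} ... e_{w_k} *)
Definition word_op (n : nat) (R : realType) (H : lmodType R[i])
    (T : 'I_n -> H -> H) (w : seq 'I_n) : H -> H :=
  foldr (fun i f => (T i) \o f) id w.

(* T_w^* = T_{w_k}^* ... T_{w_1}^*, given the adjoints Ts i = (T i)^* *)
Definition word_op_adj (n : nat) (R : realType) (H : lmodType R[i])
    (Ts : 'I_n -> H -> H) (w : seq 'I_n) : H -> H :=
  word_op Ts (rev w).

(* Gamma-family: T_i T_j = T_j T_i whenever ij in E *)
Definition Gamma_family (n : nat) (R : realType) (H : lmodType R[i])
    (E : rel 'I_n) (T : 'I_n -> H -> H) : Prop :=
  forall i j, E i j -> forall x, T i (T j x) = T j (T i x).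

(* T_{\/U} for a set U of generators: the product of the T_i (i in U) if U is
   a clique, and 0 otherwise; and its adjoint *)
Definition join_op (n : nat) (R : realType) (H : lmodType R[i])
    (E : rel 'I_n) (T : 'I_n -> H -> H) (U : {set 'I_n}) : H -> H :=
  if is_clique E U then word_op T (enum U) else fun _ => 0.

Definition join_op_adj (n : nat) (R : realType) (H : lmodType R[i])
    (E : rel 'I_n) (Ts : 'I_n -> H -> H) (U : {set 'I_n}) : H -> H :=
  if is_clique E U then word_op_adj Ts (enum U) else fun _ => 0.

(* the operator  sum_{U subset N} (-1)^{|U|} T_{\/U} T_{\/U}^*  *)
Definition brehmer_op (n : nat) (R : realType) (H : lmodType R[i])
    (E : rel 'I_n) (T Ts : 'I_n -> H -> H) (N : {set 'I_n}) : H -> H :=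
  fun h => \sum_(U : {set 'I_n} | U \subset N)
             (-1) ^+ #|U| *: join_op E T U (join_op_adj E Ts U h).

(* weak Brehmer's condition: positivity of the above operator for every
   component V_i of Gamma^c and every clique W of Gamma_i (W = set0 allowed) *)
Definition weak_brehmer (n : nat) (R : realType) (H : lmodType R[i])
    (E : rel 'I_n) (T Ts : 'I_n -> H -> H) (inner : H -> H -> R[i]) : Prop :=
  forall (x : 'I_n) (W : {set 'I_n}),
    W \subset compl_component E x -> is_clique E W ->
    forall h : H,
      0 <= inner (brehmer_op E T Ts (nbhd E (compl_component E x) W) h) h.

(* finite partial sum of ||C_{r,T} h||^2 = sum_p r^{2|p|} ||T_p^* h||^2
   over the finite set of monoid elements represented by the words in F *)
Definition cauchy_partial_sq (n : nat) (R : realType) (H : lmodType R[i])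
    (Ts : 'I_n -> H -> H) (inner : H -> H -> R[i]) (r : R)
    (F : seq (seq 'I_n)) (h : H) : R[i] :=
  \sum_(w <- F) ((r ^+ (2 * size w))%:C)%C
                  * inner (word_op_adj Ts w h) (word_op_adj Ts w h).

(* Main.v *)
(** Put [s = r^2]. For a connected component of the complement graph write
    [D_s = sum_U (-s)^|U| T_U T_U^*], [U] ranging over the cliques of the component.
    Expanding [-s = (1 - s) - 1] gives [D_s = sum_W (1 - s)^|W| T_W D_1(N(W)) T_W^*], where
    weak Brehmer makes every [Q_W := T_W D_1(N(W)) T_W^*] positive and [sum_W Q_W = D_0 = 1].
    Cartier-Foata inversion in the Artin monoid says [sum_p s^|p| T_p D_s T_p^* = 1] as a
    formal power series in [s]. Dividing by [(1 - s)^omega], whose inverse has nonnegative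
    coefficients and constant term 1, yields a coefficientwise bound of
    [sum_p s^|p| T_p T_p^*] by [(1 - s)^(-omega)], so no convergence question arises:
    power series are handled as polynomials modulo [X^(M+1)], with [sum_(i <= M) X^i]
    in the role of [1 / (1 - X)].
    Distinct components commute, so the monoid is the product of the monoids of its
    components, the bounds multiply and the clique numbers add up.

    Words are read backwards throughout, so that [T_p^*] is [word_op Ts w] with [w = rev p]. *)
Require Import Defs.
From HB Require Import structures.
From mathcomp Require Import all_boot all_order all_algebra.
From mathcomp Require Import reals complex.
From Stdlib Require Import Relations.
Set Implicit Arguments. Unset Strict Implicit. Unset Printing Implicit Defensive.
Import Order.TTheory GRing.Theory Num.Theory.
Local Open Scope ring_scope.

(** * Auxiliary facts on sequences and on sums over sequences *)

Lemma filter_rem (T : eqType) (p : pred T) (x : T) (s : seq T) :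
  filter p (rem x s) = if p x then rem x (filter p s) else filter p s.
Proof.
elim: s => [|y s IHs] /=; first by rewrite if_same.
have [->|nyx] := eqVneq y x.
  by case: (p x) => //=; rewrite eqxx.
by rewrite /= IHs; case: (p y); case: (p x) => //=; rewrite (negPf nyx).
Qed.

Lemma ler_sum_subset (K : numDomainType) (T : eqType) (f : T -> K) (s1 s2 : seq T) :
  (forall x, 0 <= f x) -> uniq s1 -> {subset s1 <= s2} ->
  \sum_(x <- s1) f x <= \sum_(x <- s2) f x.
Proof.
move=> f0; elim: s1 s2 => [|x s1 IHs] s2 /=; first by rewrite big_nil sumr_ge0.
move=> /andP[xs1 us1] s12; have xs2 : x \in s2 by rewrite s12 ?mem_head.
rewrite big_cons (perm_big _ (perm_to_rem xs2)) big_cons lerD2l.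
apply: IHs => // y ys1; have /s12 : y \in x :: s1 by rewrite inE ys1 orbT.
by rewrite (perm_mem (perm_to_rem xs2)) inE => /orP[/eqP yx|//]; rewrite -yx ys1 in xs1.
Qed.

(** * Words modulo commutation: divisibility by cliques and normal forms *)

Section Traces.
Variables (n : nat) (E : rel 'I_n).
Hypotheses (Esym : forall j k : 'I_n, E j k = E k j) (Eirr : forall j, E j j = false).
Implicit Types (w u v t : seq 'I_n) (a b c : 'I_n) (U W S : {set 'I_n}).

(* Two words represent the same element of the Artin monoid iff their projections
   to all pairs of non-adjacent (possibly equal) letters coincide. *)
Definition trace_proj w : {ffun 'I_n * 'I_n -> seq 'I_n} :=
  [ffun ab => if E ab.1 ab.2 then [::] else filter (pred2 ab.1 ab.2) w].

Lemma trace_projP u v :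
  trace_proj u = trace_proj v <->
  forall a b, ~~ E a b -> filter (pred2 a b) u = filter (pred2 a b) v.
Proof.
split=> [/ffunP eq_uv a b /negPf nab | eq_uv].
  by have := eq_uv (a, b); rewrite !ffunE /= nab.
by apply/ffunP => -[a b]; rewrite !ffunE /=; case: ifPn => // /eq_uv.
Qed.

Lemma trace_proj_cat u u' v v' : trace_proj u = trace_proj u' ->
  trace_proj v = trace_proj v' -> trace_proj (u ++ v) = trace_proj (u' ++ v').
Proof.
move=> /trace_projP eu /trace_projP ev; apply/trace_projP => a b nab.
by rewrite !filter_cat eu ?ev.
Qed.

Lemma trace_proj_catI u v v' :
  trace_proj (u ++ v) = trace_proj (u ++ v') -> trace_proj v = trace_proj v'.
Proof.
move=> /trace_projP e; apply/trace_projP => a b /e.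
by rewrite !filter_cat => /eqP; rewrite eqseq_cat // eqxx => /eqP.
Qed.

Lemma trace_proj_rev u v :
  trace_proj (rev u) = trace_proj (rev v) -> trace_proj u = trace_proj v.
Proof.
move=> /trace_projP e; apply/trace_projP => a b /e.
by rewrite !filter_rev => /(can_inj revK).
Qed.

Lemma trace_proj_perm u v : trace_proj u = trace_proj v -> perm_eq u v.
Proof.
move=> /trace_projP e; apply/allP => a _ /=; apply/eqP.
(* The projection to the pair [(a, a)] is a block of copies of [a], so its length is the
   multiplicity of [a]. *)
have := e a a; rewrite Eirr => /(_ isT)/(congr1 size).
by rewrite !size_filter; congr (_ = _); apply: eq_count => c /=; rewrite orbb.
Qed.

(** The letters that commutations can bring to the front. Reading them off the projections makes the
    set invariant at once, and the choice [b = a] forces [a] to occur in [w]. *)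
Definition initials w : {set 'I_n} :=
  [set a | [forall b, E a b || (ohead (filter (pred2 a b) w) == Some a)]].

Lemma initialsP a w :
  reflect (forall b, ~~ E a b -> ohead (filter (pred2 a b) w) = Some a)
          (a \in initials w).
Proof.
rewrite inE; apply: (iffP forallP) => H b.
  by move=> /negPf nab; have := H b; rewrite nab => /eqP.
by case: (boolP (E a b)) => //= /H ->.
Qed.

Lemma eq_initials u v : trace_proj u = trace_proj v -> initials u = initials v.
Proof.
move=> /trace_projP e; apply/setP => a.
by apply/initialsP/initialsP => H b nab; rewrite -(H b nab) e.
Qed.

Lemma head_initials a w : a \in initials (a :: w).
Proof. by apply/initialsP => b _; rewrite /= eqxx. Qed.

Lemma initials_mem a w : a \in initials w -> a \in w.
Proof.
move=> /initialsP /(_ a); rewrite Eirr => /(_ isT).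
case ef: filter => [//|c s] /= [ca]; have : c \in filter (pred2 a a) w.
  by rewrite ef mem_head.
by rewrite mem_filter ca => /andP[].
Qed.

(** Two non-adjacent initials would both head the projection to their pair. *)
Lemma initials_clique w a b : a \in initials w -> b \in initials w -> a != b -> E a b.
Proof.
move=> /initialsP Ha /initialsP Hb nab; apply: contraT => nE.
have := Hb a; rewrite Esym => /(_ nE); have := Ha b nE.
have -> : filter (pred2 b a) w = filter (pred2 a b) w.
  by apply: eq_filter => c /=; rewrite orbC.
by move=> -> [ab]; rewrite ab eqxx in nab.
Qed.

Lemma initials_cons a b w : E a b -> (a \in initials (b :: w)) = (a \in initials w).
Proof.
move=> Eab; have nba : (b == a) = false by apply: contraTF Eab => /eqP ->; rewrite Eirr.
have nbc c : ~~ E a c -> (b == c) = false.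
  by move=> nac; apply: contraNF nac => /eqP <-.
by apply/initialsP/initialsP => H c nac; have := H c nac; rewrite /= nba nbc.
Qed.

Lemma trace_proj_initial a w : a \in initials w ->
  trace_proj w = trace_proj (a :: rem a w).
Proof.
move=> /initialsP aw; apply/trace_projP => b c nbc.
have -> : filter (pred2 b c) (a :: rem a w) =
    if pred2 b c a then a :: rem a (filter (pred2 b c) w) else filter (pred2 b c) w.
  by rewrite /= filter_rem /=; case: (_ || _).
case: ifP => // abc.
suff : ohead (filter (pred2 b c) w) = Some a.
  by case: (filter _ w) => [//|d t] [->]; rewrite /= eqxx.
case/orP: abc nbc => /eqP <- nE; first exact: aw.
rewrite -(aw b) 1?Esym //; congr ohead.
by apply: eq_filter => d /=; rewrite orbC.
Qed.

Lemma word_equiv_cons a u v : word_equiv E u v -> word_equiv E (a :: u) (a :: v).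
Proof.
elim=> [_ _ [x y b c Ebc]|x|x y z _ xy _ yz].
- exact: rt_step (@ws_swap n E (a :: x) y b c Ebc).
- exact: rt_refl.
- exact: rt_trans xy yz.
Qed.

(** Every letter before the first [a] is adjacent to [a], so [a] can be swapped past them one at a
    time. *)
Lemma word_equiv_initial a w : a \in initials w -> word_equiv E (a :: rem a w) w.
Proof.
elim: w => [|c w IHw] aw; first by have := initials_mem aw.
rewrite /=; case: eqVneq => [->|nca]; first exact: rt_refl.
have Eac : E a c.
  apply: contraT => nE; move/initialsP/(_ c nE): aw => /=.
  by rewrite eqxx orbT /= => -[ca]; rewrite ca eqxx in nca.
rewrite initials_cons // in aw; apply: rt_trans (word_equiv_cons c (IHw aw)).
exact: rt_step (@ws_swap n E [::] _ a c Eac).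
Qed.

(** The first letter of [u] is initial in [v]: bring it to the front there, cancel it on both sides,
    and recurse. *)
Lemma trace_proj_word_equiv u v : trace_proj u = trace_proj v -> word_equiv E u v.
Proof.
elim: u v => [|a u IHu] v e.
  by have /perm_nilP := trace_proj_perm (esym e) => ->; exact: rt_refl.
have av : a \in initials v by rewrite -(eq_initials e) head_initials.
apply: rt_trans (word_equiv_initial av); apply/word_equiv_cons/IHu.
by apply: (@trace_proj_catI [:: a]); rewrite /= e (trace_proj_initial av).
Qed.

Lemma cliqueP U : reflect {in U &, forall i j, i != j -> E i j} (is_clique E U).
Proof.
apply: (iffP forall_inP) => H i.
  by move=> j iU jU; move/forall_inP: (H i iU) => /(_ j jU) /implyP.
by move=> iU; apply/forall_inP => j jU; apply/implyP; apply: H.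
Qed.

(** Left divisibility by the product of a clique is detected letter by letter, because splitting off
    one letter does not change which of the others are initial. *)
Lemma trace_proj_clique s w : uniq s -> {in s &, forall i j, i != j -> E i j} ->
  (exists v, trace_proj w = trace_proj (s ++ v)) <-> {subset s <= initials w}.
Proof.
elim: s w => [|a s IHs] w /=; first by split=> // _; exists w.
move=> /andP[nas us] cl.
have cl' : {in s &, forall i j, i != j -> E i j}.
  by move=> i j is_ js; apply: cl; rewrite inE ?is_ ?js orbT.
have Esa b : b \in s -> E b a.
  move=> bs; apply: cl; rewrite ?mem_head ?inE ?bs ?orbT //.
  by apply: contraNneq nas => <-.
split=> [[v e] b|sub].
  rewrite inE (eq_initials e) => /predU1P[->|bs]; first exact: head_initials.
  rewrite initials_cons ?Esa //; apply: ((IHs _ us cl').1 _ b bs).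
  by exists v.
have aw := sub a (mem_head _ _).
have [v e] : exists v, trace_proj (rem a w) = trace_proj (s ++ v).
  apply/(IHs _ us cl') => b bs.
  rewrite -(initials_cons _ (Esa b bs)) -(eq_initials (trace_proj_initial aw)).
  by apply: sub; rewrite inE bs orbT.
exists v; rewrite (trace_proj_initial aw).
exact: (@trace_proj_cat [:: a] [:: a]).
Qed.

(** By [trace_proj_clique] the word [t] divides [s] on the left, and equal lengths leave an empty
    quotient. *)
Lemma trace_proj_perm_clique s t : uniq s -> {in s &, forall i j, i != j -> E i j} ->
  perm_eq s t -> trace_proj s = trace_proj t.
Proof.
move=> us cl pst.
have [v e] : exists v, trace_proj s = trace_proj (t ++ v).
  apply/trace_proj_clique => [|i j|i]; rewrite -?(perm_uniq pst) -?(perm_mem pst) //.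
    exact: cl.
  by apply: (trace_proj_clique s us cl).1; exists [::]; rewrite cats0.
suff v0 : v = [::] by rewrite v0 cats0 in e.
apply/eqP; rewrite -size_eq0 -(eqn_add2l (size t)) addn0 -size_cat.
by rewrite -(perm_size (trace_proj_perm e)) (perm_size pst).
Qed.

(** The result of [choose] depends on the class alone, so these words stand in for the elements of
    the quotient monoid. *)
Definition trace_rep w : seq 'I_n :=
  choose (fun u => trace_proj u == trace_proj w) w.

Lemma trace_repK w : trace_proj (trace_rep w) = trace_proj w.
Proof. by apply/eqP; apply: (chooseP (P := fun u => trace_proj u == _)). Qed.

Lemma eq_trace_rep u v : trace_proj u = trace_proj v -> trace_rep u = trace_rep v.
Proof.
move=> e; rewrite /trace_rep e; apply: choose_id; by rewrite ?e.
Qed.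

Lemma trace_rep_perm w : perm_eq (trace_rep w) w.
Proof. exact/trace_proj_perm/trace_repK. Qed.

Lemma trace_rep_idem w : trace_rep (trace_rep w) = trace_rep w.
Proof. exact/eq_trace_rep/trace_repK. Qed.

(** These words are in bijection with the elements of length [m] of the submonoid generated by
    [S]. *)
Definition trace_nf S m : seq (seq 'I_n) :=
  [seq x <- map val (enum {: m.-tuple 'I_n}) | all (mem S) x && (trace_rep x == x)].

Lemma trace_nf_uniq S m : uniq (trace_nf S m).
Proof. by rewrite filter_uniq // map_inj_uniq ?enum_uniq //; apply: val_inj. Qed.

Lemma mem_trace_nf S m w :
  (w \in trace_nf S m) = [&& size w == m, all (mem S) w & trace_rep w == w].
Proof.
rewrite mem_filter andbC; congr (_ && _); apply/mapP/eqP => [[x _ ->]|sw].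
  by rewrite size_tuple.
exists (tcast sw (in_tuple w)); first by rewrite mem_enum.
by rewrite -[RHS]/(tval _) val_tcast.
Qed.

Lemma trace_rep_nf S m w : (trace_rep w \in trace_nf S m) = (size w == m) && all (mem S) w.
Proof.
rewrite mem_trace_nf trace_rep_idem eqxx andbT (perm_size (trace_rep_perm w)).
by rewrite (perm_all _ (trace_rep_perm w)).
Qed.

(** Left multiplication by the product of [U] is injective by cancellation, and [trace_proj_clique]
    identifies its image as the elements whose initials contain [U]. *)
Lemma sum_trace_nf_clique (K : nmodType) (f : seq 'I_n -> K) S m U :
    (forall u v, trace_proj u = trace_proj v -> f u = f v) ->
    U \subset S -> is_clique E U ->
  \sum_(w <- trace_nf S m) f (enum U ++ w) =
  \sum_(w <- trace_nf S (#|U| + m) | U \subset initials w) f w.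
Proof.
move=> finv /subsetP US /cliqueP clU.
have cl : {in enum U &, forall i j, i != j -> E i j}.
  by move=> i j; rewrite !mem_enum; apply: clU.
pose g w := trace_rep (enum U ++ w).
rewrite -[RHS]big_filter.
have -> : \sum_(w <- trace_nf S m) f (enum U ++ w) = \sum_(w <- map g (trace_nf S m)) f w.
  by rewrite big_map; apply: eq_bigr => w _; apply: finv; rewrite trace_repK.
apply: perm_big; apply: uniq_perm.
- rewrite map_inj_in_uniq ?trace_nf_uniq // => u v.
  rewrite !mem_trace_nf => /and3P[_ _ /eqP <-] /and3P[_ _ /eqP <-] /(congr1 trace_proj).
  rewrite !trace_repK => /trace_proj_catI; rewrite !trace_repK; exact: eq_trace_rep.
- by rewrite filter_uniq ?trace_nf_uniq.
move=> w; rewrite mem_filter; apply/mapP/andP => [[v] | [/subsetP Uw]].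
  rewrite mem_trace_nf => /and3P[/eqP sv Sv _] ->; split.
    apply/subsetP => a aU; have [+ _] := trace_proj_clique (g v) (enum_uniq U) cl.
    by apply; rewrite ?mem_enum // ; exists v; rewrite trace_repK.
  rewrite trace_rep_nf size_cat -cardE sv eqxx all_cat Sv andbT /=.
  by apply/allP => a; rewrite mem_enum => /US.
rewrite mem_trace_nf => /and3P[/eqP sw Sw /eqP nw].
have [_ /(_ _)[|v e]] := trace_proj_clique w (enum_uniq U) cl.
  by move=> a; rewrite mem_enum; apply: Uw.
have := trace_proj_perm e => pe.
exists (trace_rep v).
  rewrite trace_rep_nf -(eqn_add2l #|U|) -sw (perm_size pe) size_cat -cardE eqxx /=.
  by move: Sw; rewrite (perm_all _ pe) all_cat => /andP[].
rewrite -nw; apply: eq_trace_rep; rewrite e; apply: trace_proj_cat => //.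
by rewrite trace_repK.
Qed.
End Traces.

(** * Binomial sums over subsets and truncated geometric series *)

Lemma sum_subset_exprD (K : comNzRingType) (T : finType) (A : {set T}) (x y : K) :
  \sum_(J : {set T} | J \subset A) x ^+ #|J| * y ^+ #|A :\: J| = (x + y) ^+ #|A|.
Proof.
(* Factors outside [A] are [0 + 1], so expanding the product kills every [J] not contained in
   [A]. *)
pose F (i : T) := if i \in A then x else 0; pose G (i : T) := if i \in A then y else 1.
transitivity (\prod_i (F i + G i)); last first.
  rewrite (bigID (mem A)) /= [X in _ * X]big1 => [|i /negPf iA].
    by rewrite mulr1 -prodr_const; apply: eq_bigr => i iA; rewrite /F /G iA.
  by rewrite /F /G iA add0r.
rewrite bigA_distr /= [RHS](bigID (fun J : {set T} => J \subset A)) /=.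
rewrite [X in _ = _ + X]big1 => [|J /subsetPn[i iJ niA]]; last first.
  by rewrite (bigD1 i) //= iJ /F (negPf niA) mul0r.
rewrite addr0; apply: eq_bigr => J /subsetP JA.
rewrite (bigID (mem J)) /=; congr (_ * _).
  by rewrite -prodr_const; apply: eq_bigr => i iJ; rewrite iJ /F JA.
rewrite [RHS](bigID (mem A)) /= [X in _ = _ * X]big1 => [|i /andP[/negPf-> /negPf iA]].
  rewrite mulr1 -prodr_const; apply: eq_big => [i|i]; first by rewrite inE.
  by rewrite inE => /andP[/negPf-> iA]; rewrite /G iA.
by rewrite /G iA.
Qed.

Section TruncatedGeometricSeries.
Variables (K : numDomainType) (M : nat).

Definition geom_poly : {poly K} := \sum_(i < M.+1) 'X^i.

Lemma geom_polyM : (1 - 'X) * geom_poly = 1 - 'X^(M.+1).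
Proof.
rewrite -{2}(expr1n _ M.+1) subrXX; congr (_ * _).
by apply: eq_bigr => i _; rewrite expr1n mul1r.
Qed.

Lemma coefM_ge0 (p q : {poly K}) : (forall i, 0 <= p`_i) -> (forall i, 0 <= q`_i) ->
  forall i, 0 <= (p * q)`_i.
Proof. by move=> p0 q0 i; rewrite coefM sumr_ge0 // => j _; rewrite mulr_ge0. Qed.

(** Induction through [G^(k+1) - 1 = G (G^k - 1) + (G - 1)], where [G - 1] is again a sum of
    monomials. *)
Lemma coef_geom_polyX_sub1_ge0 k i : 0 <= (geom_poly ^+ k - 1)`_i.
Proof.
have X_ge0 (j : 'I_M.+1) l : 0 <= ('X^j : {poly K})`_l by rewrite coefXn ler0n.
have G_ge0 j : 0 <= geom_poly`_j by rewrite coef_sum sumr_ge0.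
elim: k i => [|k IHk] i; first by rewrite subrr coef0.
have -> : geom_poly ^+ k.+1 - 1 = geom_poly * (geom_poly ^+ k - 1) + (geom_poly - 1).
  by rewrite mulrBr mulr1 addrA subrK exprS.
rewrite coefD addr_ge0 ?coefM_ge0 //.
rewrite /geom_poly big_ord_recl expr0 addrC addKr coef_sum sumr_ge0 // => j _.
Qed.

Lemma coef_geom_polyX_ge (p : {poly K}) k m :
  (forall i, 0 <= p`_i) -> p`_m <= (geom_poly ^+ k * p)`_m.
Proof.
move=> p0; rewrite -subr_ge0 -coefB -{2}[p]mul1r -mulrBl.
exact: coefM_ge0 (coef_geom_polyX_sub1_ge0 k) p0 m.
Qed.

(** This is reduction modulo [X^(M+1)]: powers of [1 - X^(M+1)] act as [1] on coefficients up to
    [M]. *)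
Lemma coef_truncX (p : {poly K}) k m : (m <= M)%N ->
  ((1 - 'X^(M.+1)) ^+ k * p)`_m = p`_m.
Proof.
move=> mM; elim: k => [|k IHk]; first by rewrite mul1r.
by rewrite exprS -mulrA mulrBl mul1r coefB IHk coefXnM ltnS mM subr0.
Qed.
End TruncatedGeometricSeries.

(** * Cartier-Foata inversion and the coefficientwise bound *)

Section Mobius.
Variables (n : nat) (E : rel 'I_n).
Hypotheses (Esym : forall j k : 'I_n, E j k = E k j) (Eirr : forall j, E j j = false).
Variables (K : numDomainType) (S : {set 'I_n}) (f : seq 'I_n -> K).
Hypothesis f_inv : forall u v, trace_proj E u = trace_proj E v -> f u = f v.

Let P (U : {set 'I_n}) := (U \subset S) && is_clique E U.

Lemma trace_nf0 : trace_nf E S 0 = [:: [::]].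
Proof.
apply: perm_small_eq => //; apply: uniq_perm; rewrite ?trace_nf_uniq // => w.
rewrite mem_trace_nf inE; case: w => [|//] /=; apply/eqP/nilP.
by rewrite /nilp (perm_size (trace_rep_perm Eirr [::])).
Qed.

(** After exchanging the sums, each word [w] carries the alternating sum over all subsets of its
    initials, which are automatically cliques; this vanishes unless [w] is empty. *)
Lemma mobius_trace_nf m :
  \sum_(U : {set 'I_n} | P U && (#|U| <= m)%N)
     (-1) ^+ #|U| * \sum_(w <- trace_nf E S (m - #|U|)) f (enum U ++ w)
  = f [::] *+ (m == 0)%N.
Proof.
transitivity (\sum_(w <- trace_nf E S m)
   \sum_(U : {set 'I_n} | U \subset initials E w) (-1) ^+ #|U| * f w).
  rewrite [RHS]big_seq (exchange_big_dep (fun U : {set 'I_n} => P U && (#|U| <= m)%N)) /=.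
    apply: eq_bigr => U /andP[/andP[US clU] Um].
    by rewrite (sum_trace_nf_clique Esym Eirr) // subnKC // mulr_sumr big_seq_cond.
  move=> w U; rewrite mem_trace_nf => /and3P[/eqP sw /allP Sw _] /subsetP Uw.
  have Uw' : {subset enum U <= w} by move=> a; rewrite mem_enum => /Uw /(initials_mem Eirr).
  rewrite -sw cardE uniq_leq_size ?enum_uniq // andbT; apply/andP; split.
    by apply/subsetP => a aU; apply/Sw/Uw'; rewrite mem_enum.
  by apply/cliqueP => i j /Uw iw /Uw jw; apply: (initials_clique Esym iw jw).
case: m => [|m].
  rewrite trace_nf0 big_seq1.
  have -> : initials E [::] = set0.
    by apply/setP => a; rewrite in_set0; apply/negP => /(initials_mem Eirr).
  rewrite (big_pred1 set0) ?cards0 ?mul1r // => U; exact: subset0.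
rewrite big_seq big1 // => w; rewrite mem_trace_nf => /and3P[/eqP sw _ _].
rewrite -mulr_suml.
(* A nonempty word has its first letter among its initials, so this sum is [(-1 + 1)^k] with
   [k > 0]. *)
suff -> : \sum_(U : {set 'I_n} | U \subset initials E w) (-1) ^+ #|U| = 0 :> K.
  by rewrite mul0r.
have := sum_subset_exprD (initials E w) (-1 : K) 1; rewrite addNr expr0n.
have -> : #|initials E w| == 0%N = false.
  apply/negP; case: w sw => // a w _; rewrite cards_eq0 => /eqP e.
  by have := head_initials E a w; rewrite e inE.
by rewrite mulr0n => e; rewrite -[RHS]e; apply: eq_bigr => U _; rewrite expr1n mulr1.
Qed.

(** When [f w] is the squared norm of [word_op Ts w h], this is weak Brehmer tested at the vector
    [word_op Ts (enum W ++ w) h]. *)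
Hypothesis f_brehmer :
  forall (W : {set 'I_n}) (w : seq 'I_n), W \subset S -> is_clique E W ->
  0 <= \sum_(U : {set 'I_n} | (U \subset nbhd E S W) && is_clique E U)
         (-1) ^+ #|U| * f (enum U ++ enum W ++ w).

Lemma trace_proj_enumD (W U : {set 'I_n}) w : is_clique E U -> W \subset U ->
  trace_proj E (enum U ++ w) = trace_proj E (enum (U :\: W) ++ enum W ++ w).
Proof.
move=> /cliqueP clU WU; rewrite catA; apply: trace_proj_cat => //.
apply: (trace_proj_perm_clique Esym Eirr (enum_uniq U)) => [i j|].
  by rewrite !mem_enum; apply: clU.
apply: uniq_perm; rewrite ?enum_uniq ?cat_uniq ?enum_uniq ?andbT //=.
  by apply/hasPn => i; rewrite !mem_enum inE => ->.
move=> i; rewrite mem_cat !mem_enum inE; case: (boolP (i \in W)) => [/(subsetP WU)->|] //=.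
by rewrite orbF.
Qed.

(** The cliques of [S] containing [W] are the disjoint unions of [W] with a clique of [N(W)], so
    reindexing gives [f_brehmer]. *)
Lemma brehmer_superset_ge0 (W : {set 'I_n}) w : W \subset S -> is_clique E W ->
  0 <= \sum_(U : {set 'I_n} | P U && (W \subset U))
         (-1) ^+ #|U :\: W| * f (enum U ++ w).
Proof.
move=> WS clW; suff -> : \sum_(U : {set 'I_n} | P U && (W \subset U))
    (-1) ^+ #|U :\: W| * f (enum U ++ w) =
  \sum_(U : {set 'I_n} | (U \subset nbhd E S W) && is_clique E U)
    (-1) ^+ #|U| * f (enum U ++ enum W ++ w) by exact: f_brehmer.
have PD (U : {set 'I_n}) : (P U && (W \subset U)) =
    [&& U :\: W \subset nbhd E S W, is_clique E (U :\: W) & W \subset U].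
  apply/andP/and3P => [[/andP[/subsetP US /cliqueP clU] WU]
                      |[/subsetP UN /cliqueP clU WU]]; split => //.
  - apply/subsetP => i; rewrite !inE => /andP[iW iU]; rewrite US //=.
    apply/forall_inP => j jW; apply: clU => //; first exact: (subsetP WU).
    by apply: contraNneq iW => ->.
  - by apply/cliqueP => i j; rewrite !inE => /andP[_ iU] /andP[_ jU]; apply: clU.
  have UWN i j : i \in U :\: W -> j \in W -> E i j.
    by move=> /UN; rewrite inE => /andP[_ /forall_inP]; apply.
  apply/andP; split.
    apply/subsetP => i iU; have [/(subsetP WS)//|niW] := boolP (i \in W).
    have /UN : i \in U :\: W by rewrite inE niW.
    by rewrite inE => /andP[].
  apply/cliqueP => i j iU jU nij.
  have [iW|niW] := boolP (i \in W); have [jW|njW] := boolP (j \in W).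
  - by move/cliqueP: clW; apply.
  - by rewrite Esym UWN // inE njW.
  - by rewrite UWN // inE niW.
  - by apply: clU; rewrite ?inE ?niW ?njW.
rewrite (reindex_onto (fun U => U :|: W) (fun U => U :\: W)) /=; last first.
  move=> U /andP[_ /subsetP WU]; apply/setP => a; rewrite !inE.
  by case: (boolP (a \in W)) => [/WU->|] //=; rewrite orbF.
apply: eq_big => [U|U].
  rewrite PD subsetUr andbT; apply/andP/idP => [[+ /eqP e]|]; rewrite ?e //.
  (* Irreflexivity of [E] keeps [N(W)] disjoint from [W]. *)
  move=> UN; suff e : (U :|: W) :\: W = U by rewrite e eqxx.
  rewrite setDUl setDv setU0; apply/setDidPl; rewrite -setI_eq0; apply/eqP/setP => a.
  rewrite !inE; apply/negP => /andP[aU aW]; move: UN => /andP[/subsetP/(_ a aU)].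
  by rewrite inE => /andP[_ /forall_inP/(_ a aW)]; rewrite Eirr.
move=> /andP[/andP[/andP[_ cl] _] /eqP e]; rewrite e; congr (_ * _); apply: f_inv.
by rewrite (@trace_proj_enumD W (U :|: W)) ?subsetUr ?e.
Qed.

Variables (omega M : nat).
Hypothesis clique_le :
  forall W : {set 'I_n}, W \subset S -> is_clique E W -> (#|W| <= omega)%N.

(** Multiplying the Cartier-Foata identity by [G^omega] turns each [(1 - X)^|W| B W] into
    [G^(omega - |W|) B W] modulo [X^(M+1)], which dominates [B W] coefficientwise. *)
Lemma trace_nf_sum_le m : (m <= M)%N ->
  \sum_(w <- trace_nf E S m) f w <= f [::] * (geom_poly K M ^+ omega)`_m.
Proof.
move=> mM; set G := geom_poly K M.
(* [A U] is the truncated generating series of [f] over multiples of [U], with the degree of [U]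
   removed; [B W] is the series attached to [Q_W]. *)
pose A (U : {set 'I_n}) := \poly_(j < M.+1) \sum_(w <- trace_nf E S j) f (enum U ++ w).
pose B (W : {set 'I_n}) :=
  \sum_(U : {set 'I_n} | P U && (W \subset U)) (-1) ^+ #|U :\: W| *: A U.
have PS (U W : {set 'I_n}) : P U -> W \subset U -> P W.
  move=> /andP[US /cliqueP clU] WU; rewrite /P (subset_trans WU US).
  by apply/cliqueP => i j iW jW; apply: clU; apply: (subsetP WU).
have AB : \sum_(U | P U) (- 'X) ^+ #|U| * A U = \sum_(W | P W) (1 - 'X) ^+ #|W| * B W.
  transitivity (\sum_(U | P U) \sum_(W : {set 'I_n} | W \subset U)
       (1 - 'X) ^+ #|W| * ((-1) ^+ #|U :\: W| *: A U)).
    apply: eq_bigr => U _.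
    have {1}-> : - 'X = (1 - 'X) + (-1) :> {poly K} by rewrite addrAC subrr add0r.
    rewrite -sum_subset_exprD mulr_suml; apply: eq_bigr => W _.
    by rewrite -mulrA -[in RHS]mul_polyC rmorphXn rmorphN1.
  rewrite (exchange_big_dep P) /=; last by move=> U W; apply: PS.
  by apply: eq_bigr => W _; rewrite /B mulr_sumr.
(* The same expansion with [1 - X] replaced by [1]: alternating sums over the subsets of [U] leave
   only [U = set0]. *)
have B0 : \sum_(W | P W) B W = A set0.
  transitivity (\sum_(U | P U) \sum_(W : {set 'I_n} | W \subset U) (-1) ^+ #|U :\: W| *: A U).
    by rewrite [RHS](exchange_big_dep P) //= => U W; apply: PS.
  have P0 : P set0 by rewrite /P sub0set; apply/cliqueP => i j; rewrite inE.
  rewrite (bigD1 set0) //= (big_pred1 set0) => [|W]; last exact: subset0.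
  rewrite setDv cards0 scale1r big1 ?addr0 // => U /andP[_ U0].
  rewrite -scaler_suml.
  have := sum_subset_exprD U (1 : K) (-1); rewrite subrr expr0n cards_eq0 (negPf U0).
  by under eq_bigr do rewrite expr1n mul1r; move=> ->; rewrite scale0r.
have Bn W : P W -> forall j, 0 <= (B W)`_j.
  move=> /andP[WS clW] j; rewrite coef_sum.
  have [jM|jM] := ltnP j M.+1; last first.
    by rewrite big1 // => U _; rewrite coefZ coef_poly ltnNge jM mulr0.
  under eq_bigr do rewrite coefZ coef_poly jM mulr_sumr.
  by rewrite exchange_big /=; apply: sumr_ge0 => w _; apply: brehmer_superset_ge0.
(* Truncation at [M] is invisible in these degrees, so the product is the constant [f [::]] modulo
   [X^(M+1)]. *)
have mob j : (j <= M)%N -> (\sum_(U | P U) (- 'X) ^+ #|U| * A U)`_j = f [::] *+ (j == 0)%N.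
  move=> jM; rewrite -mobius_trace_nf coef_sum [RHS]big_mkcondr; apply: eq_bigr => U _.
  have -> : (- 'X) ^+ #|U| * A U = (-1) ^+ #|U| *: ('X^(#|U|) * A U).
    by rewrite [(- 'X) ^+ _]exprNn -mulrA -mul_polyC rmorphXn rmorphN1.
  rewrite coefZ coefXnM coef_poly; case: (ltnP j #|U|) => Uj; first by rewrite mulr0.
  by rewrite ltnS (leq_trans (leq_subr _ _)).
have -> : f [::] * (G ^+ omega)`_m = (G ^+ omega * \sum_(U | P U) (- 'X) ^+ #|U| * A U)`_m.
  rewrite coefM big_ord_recr /= subnn mob // mulr1n mulrC big1 ?add0r // => i _.
  by rewrite mob ?(leq_trans (leq_subr _ _)) // subn_eq0 leqNgt ltn_ord mulr0n mulr0.
rewrite AB mulr_sumr coef_sum.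
have -> : \sum_(w <- trace_nf E S m) f w = (A set0)`_m.
  by rewrite coef_poly ltnS mM; apply: eq_bigr => w _; rewrite enum_set0.
rewrite -B0 coef_sum; apply: ler_sum => W PW.
have /andP[WS clW] := PW.
(* Of the [omega] factors [G], [#|W|] are paired with the factors [1 - X]; the others can only
   increase the coefficients. *)
rewrite -[in leRHS](subnK (clique_le WS clW)) exprD -mulrA [G ^+ #|W| * _]mulrA -exprMn.
rewrite [G * _]mulrC geom_polyM mulrCA coef_truncX //.
exact/coef_geom_polyX_ge/Bn.
Qed.
End Mobius.

(** The left side is a partial sum of [G^k] evaluated at [s], with nonnegative terms, and
    [(1 - s) G(s) = 1 - s^(M+1) <= 1]. *)
Lemma sum_coef_geom_polyX_le (K : numFieldType) (M k : nat) (s : K) : 0 <= s < 1 ->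
  \sum_(m < M.+1) (geom_poly K M ^+ k)`_m * s ^+ m <= ((1 - s) ^+ k)^-1.
Proof.
move=> /andP[s0 s1]; set G := geom_poly K M.
have s1' : 0 < 1 - s by rewrite subr_gt0.
have Gk0 i : 0 <= (G ^+ k)`_i.
  rewrite -[G ^+ k]mulr1; apply: le_trans (coef_geom_polyX_ge M k i _) => [|j].
    by rewrite coef1 ler0n.
  by rewrite coef1 ler0n.
apply: (@le_trans _ _ (G ^+ k).[s]).
  (* The padded length covers all coefficients and lets the first [M.+1] terms be split off. *)
  rewrite (@horner_coef_wide _ (M.+1 + size (G ^+ k))) ?leq_addl //.
  by rewrite big_split_ord /= lerDl sumr_ge0 // => i _; rewrite mulr_ge0 ?exprn_ge0.
have Gs : G.[s] <= (1 - s)^-1.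
  have /(congr1 (fun p => p.[s])) := geom_polyM K M; rewrite !hornerE => e.
  by rewrite -[leRHS]mul1r ler_pdivlMr // mulrC e gerBl exprn_ge0.
rewrite horner_exp -exprVn lerXn2r ?nnegrE ?invr_ge0 ?(ltW s1') //.
by rewrite horner_sum sumr_ge0 // => i _; rewrite hornerXn exprn_ge0.
Qed.

(** * Operator bounds: one component, then commuting products of components *)

Section Hilbert.
Variables (R : realType) (n : nat) (E : rel 'I_n).
Hypotheses (Esym : forall j k : 'I_n, E j k = E k j) (Eirr : forall j, E j j = false).
Variables (H : lmodType R[i]) (inner : H -> H -> R[i]).
Hypothesis Hinner : is_inner_product inner.
Variables (T Ts : 'I_n -> H -> H).
Hypothesis Hadj : forall (j : 'I_n) (x y : H), inner (T j x) y = inner x (Ts j y).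
Hypothesis Hfam : Gamma_family E T.
Hypothesis Hbrehmer : weak_brehmer E T Ts inner.
Variable s : R[i].
Hypothesis s01 : 0 <= s < 1.

Let s0 : 0 <= s. Proof. by case/andP: s01. Qed.
Let s1 : 0 < 1 - s. Proof. by case/andP: s01; rewrite subr_gt0. Qed.

Let nrm x := inner x x.
Let nrm0 x : 0 <= nrm x. Proof. by case: Hinner => _ _ pos _; apply: pos. Qed.

Lemma inner_sumZl (I : finType) (P : pred I) (a : I -> R[i]) (x : I -> H) y :
  inner (\sum_(i | P i) a i *: x i) y = \sum_(i | P i) a i * inner (x i) y.
Proof.
case: Hinner => lin _ _ _.
have i0 : inner 0 y = 0.
  have := lin 1 0 0 y; rewrite scale1r addr0 mul1r => /eqP.
  by rewrite -subr_eq0 opprD addNKr oppr_eq0 => /eqP.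
elim/big_rec2: _ => [//|i b v _ <-]; exact: lin.
Qed.

Lemma inner_inj (x y : H) : (forall z, inner z x = inner z y) -> x = y.
Proof.
case: Hinner => lin sym _ def xy; apply/eqP; rewrite -subr_eq0; apply/eqP/def.
by rewrite addrC -scaleN1r lin [inner x _]sym xy -sym mulN1r addNr.
Qed.

Lemma adjoint_comm i j x : E i j -> Ts i (Ts j x) = Ts j (Ts i x).
Proof. by move=> Eij; apply: inner_inj => z; rewrite -!Hadj Hfam // Esym. Qed.

Lemma word_op_cat (S : 'I_n -> H -> H) u v x :
  word_op S (u ++ v) x = word_op S u (word_op S v x).
Proof. by elim: u => //= a u ->. Qed.

Lemma word_op_trace u v x : trace_proj E u = trace_proj E v ->
  word_op Ts u x = word_op Ts v x.
Proof.
move=> /(trace_proj_word_equiv Esym Eirr); elim=> {u v} [_ _ [u v a b Eab]|//|u v w _ -> //].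
by rewrite !word_op_cat /= adjoint_comm.
Qed.

Lemma inner_word_op w x y : inner (word_op T w x) y = inner x (word_op_adj Ts w y).
Proof.
elim: w y => //= a w IHw y.
by rewrite Hadj IHw /word_op_adj rev_cons -cats1 word_op_cat.
Qed.

(** Moving [T_U] across the inner product gives squared norms; the reversal in the adjoint is
    harmless because the letters of a clique commute. *)
Lemma inner_brehmer_op N x : inner (brehmer_op E T Ts N x) x =
  \sum_(U : {set 'I_n} | (U \subset N) && is_clique E U)
     (-1) ^+ #|U| * nrm (word_op Ts (enum U) x).
Proof.
rewrite inner_sumZl big_mkcondr; apply: eq_bigr => U _; rewrite /join_op /join_op_adj.
case: ifPn => clU; last first.
  (* The empty sum supplies [inner 0 x = 0]. *)
  have := inner_sumZl pred0 (fun _ : bool => 0) (fun=> 0) x.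
  by rewrite !big_pred0_eq => ->; rewrite mulr0.
have e : word_op_adj Ts (enum U) x = word_op Ts (enum U) x.
  apply/esym/word_op_trace; apply: (trace_proj_perm_clique Esym Eirr (enum_uniq U)).
    by move=> i j; rewrite !mem_enum; apply: (cliqueP _ _ clU).
  by rewrite perm_sym perm_rev.
by rewrite inner_word_op e.
Qed.

(** Finite families of distinct monoid elements encode the infinite sum. Quantifying over [h] allows
    the bound to be applied again at a vector [word_op Ts u h]. *)
Definition cauchy_bounded (S : {set 'I_n}) (k : nat) := forall h (F : seq (seq 'I_n)),
  uniq (map (trace_rep E) F) -> all (all (mem S)) F ->
  \sum_(w <- F) s ^+ size w * nrm (word_op Ts w h) <= nrm h / (1 - s) ^+ k.

Lemma cauchy_bounded_set0 : cauchy_bounded set0 0.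
Proof.
move=> h F /map_uniq uF /allP F0; rewrite divr1.
have -> : nrm h = \sum_(w <- [:: [::]]) s ^+ size w * nrm (word_op Ts w h).
  by rewrite big_seq1 mul1r.
apply: ler_sum_subset uF _ => [w|w /F0]; first by rewrite mulr_ge0 ?exprn_ge0.
by case: w => //= a w; rewrite inE.
Qed.

(** A largest clique of the component provides the exponent; keeping it as a witness lets the
    exponents of several components be added. *)
Lemma cauchy_bounded_component x : exists W : {set 'I_n},
  [/\ W \subset compl_component E x, is_clique E W &
      cauchy_bounded (compl_component E x) #|W|].
Proof.
set C := compl_component E x.
pose P (W : {set 'I_n}) := (W \subset C) && is_clique E W.
have P0 : P set0.
  by rewrite /P sub0set; apply/cliqueP => i j; rewrite inE.
case: (@arg_maxnP _ set0 P (fun W : {set 'I_n} => #|W|) P0) => W /andP[WC clW] maxW.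
exists W; split=> // h F uF /allP FC.
pose f w := nrm (word_op Ts w h).
have f_inv u v : trace_proj E u = trace_proj E v -> f u = f v.
  by move=> e; rewrite /f (word_op_trace _ e).
pose M := \max_(w <- F) size w.
have bound m : (m <= M)%N ->
    \sum_(w <- trace_nf E C m) f w <= nrm h * (geom_poly R[i] M ^+ #|W|)`_m.
  apply: (trace_nf_sum_le Esym Eirr f_inv) => [V w VC clV|V VC clV].
    have := Hbrehmer VC clV (word_op Ts (enum V ++ w) h); rewrite inner_brehmer_op.
    by under [in X in _ -> X]eq_bigr do rewrite /f word_op_cat.
  by apply: maxW; rewrite /P VC.
(* All terms are nonnegative, so [F] is enlarged to every element of length at most [M] and graded
   by length. *)
apply: le_trans (_ : \sum_(m < M.+1) \sum_(w <- trace_nf E C m) s ^+ size w * f w <= _).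
  rewrite -(@big_mkord _ _ _ _ xpredT
              (fun m => \sum_(w <- trace_nf E C m) s ^+ size w * f w)).
  rewrite -(@big_allpairs_dep _ _ _ _ _ _ (fun _ w => w) _ (trace_nf E C)
              (fun w => s ^+ size w * f w)).
  have -> : \sum_(w <- F) s ^+ size w * nrm (word_op Ts w h) =
            \sum_(w <- map (trace_rep E) F) s ^+ size w * f w.
    rewrite big_map; apply: eq_bigr => w _.
    by rewrite (perm_size (trace_rep_perm Eirr w)) (f_inv _ _ (trace_repK E w)).
  apply: ler_sum_subset uF _ => [w|_ /mapP[w wF ->]]; first by rewrite mulr_ge0 ?exprn_ge0 ?nrm0.
  apply/allpairsPdep; exists (size w), (trace_rep E w); split=> //.
    by rewrite mem_index_iota ltnS; apply: leq_bigmax_seq.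
  by rewrite trace_rep_nf // eqxx FC.
apply: (@le_trans _ _ (nrm h * \sum_(m < M.+1) (geom_poly R[i] M ^+ #|W|)`_m * s ^+ m)).
  rewrite mulr_sumr; apply: ler_sum => m _.
  rewrite mulrA; apply: le_trans (ler_wpM2r (exprn_ge0 m s0) (bound m (leq_ord m))).
  rewrite mulr_suml !big_seq; apply: ler_sum => w; rewrite mem_trace_nf => /and3P[/eqP -> _ _].
  by rewrite mulrC.
by rewrite ler_wpM2l // sum_coef_geom_polyX_le.
Qed.

(** If [a] and [b] are not adjacent, their occurrences in [w] lie on one side only, so each
    projection sees just one of the two factors. *)
Lemma trace_proj_join (S1 S2 : {set 'I_n}) w :
  {in S1 & S2, forall i j, E i j} -> all (mem (S1 :|: S2)) w ->
  trace_proj E w = trace_proj E (filter (mem S1) w ++ filter (mem S2) w).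
Proof.
move=> E12 /allP wS; apply/trace_projP => a b nab; rewrite filter_cat.
have sub (S S' : {set 'I_n}) : {in S & S', forall i j, E i j} ->
    {in w, forall x, pred2 a b x -> x \in S} ->
    filter (pred2 a b) (filter (mem S) w) = filter (pred2 a b) w /\
    filter (pred2 a b) (filter (mem S') w) = [::].
  move=> ESS' wSx; rewrite -!filter_predI; split.
    by apply: eq_in_filter => x xw /=; case: (boolP (_ || _)) => // /(wSx x xw) ->.
  rewrite -(filter_pred0 w); apply: eq_in_filter => x xw /=; apply/negP => /andP[abx xS'].
  by have := ESS' x x (wSx x xw abx) xS'; rewrite Eirr.
have [/hasP[x xw /andP[abx xS1]]|/hasPn all1] :=
    boolP (has (fun x => pred2 a b x && (x \notin S1)) w); last first.
  have [|-> ->] := sub S1 S2 E12; last by rewrite cats0.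
  by move=> x xw abx; have := all1 x xw; rewrite abx negbK.
have xS2 : x \in S2 by have : x \in S1 :|: S2 := wS x xw; rewrite inE (negPf xS1).
have [i j iS2 jS1||-> ->] // := sub S2 S1; first by rewrite Esym E12.
move=> y yw aby; apply: contraT => yS2.
(* A letter [y] outside [S2] would be adjacent to [x], yet both belong to the non-adjacent pair [a],
   [b]. *)
have yS1 : y \in S1 by have : y \in S1 :|: S2 := wS y yw; rewrite inE (negPf yS2) orbF.
have := E12 y x yS1 xS2; move: abx aby nab => /= /orP[]/eqP-> /orP[]/eqP->.
- by rewrite Eirr.
- by rewrite Esym => /negPf->.
- by move=> /negPf->.
- by rewrite Eirr.
Qed.

(** Factor each word into its two parts, bound the inner sum at the vector [word_op Ts u h] by
    [bd1], then the sum over [u] by [bd2]. *)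
Lemma cauchy_bounded_join (S1 S2 : {set 'I_n}) k1 k2 :
  {in S1 & S2, forall i j, E i j} ->
  cauchy_bounded S1 k1 -> cauchy_bounded S2 k2 -> cauchy_bounded (S1 :|: S2) (k1 + k2).
Proof.
move=> E12 bd1 bd2 h F uF /allP FS.
pose rp (S : {set 'I_n}) w := trace_rep E (filter (mem S) w).
(* The [S2] part comes first because it is the right factor of the word, which acts first on [h]. *)
pose g w := (rp S2 w, rp S1 w).
pose t (x : seq 'I_n * seq 'I_n) :=
  s ^+ size x.1 * (s ^+ size x.2 * nrm (word_op Ts x.2 (word_op Ts x.1 h))).
have gK w : w \in F -> trace_proj E w = trace_proj E ((g w).2 ++ (g w).1).
  move=> wF; rewrite (trace_proj_join E12 (FS w wF)).
  by apply: trace_proj_cat; rewrite trace_repK.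
have -> : \sum_(w <- F) s ^+ size w * nrm (word_op Ts w h) = \sum_(x <- map g F) t x.
  rewrite big_map !big_seq; apply: eq_bigr => w /gK e.
  rewrite /t mulrA -exprD (word_op_trace _ e) word_op_cat.
  by rewrite (perm_size (trace_proj_perm Eirr e)) size_cat addnC.
pose L S := undup (map (rp S) F).
have uL S : uniq (map (trace_rep E) (L S)).
  rewrite map_id_in ?undup_uniq // => w; rewrite mem_undup => /mapP[v _ ->].
  exact: trace_rep_idem.
have aL (S : {set 'I_n}) : all (all (mem S)) (L S).
  apply/allP => w; rewrite mem_undup => /mapP[v _ ->].
  by rewrite (perm_all _ (trace_rep_perm Eirr _)) filter_all.
have t0 x : 0 <= t x by rewrite !mulr_ge0 ?exprn_ge0.
apply: (@le_trans _ _ (\sum_(x <- [seq (u, v) | u <- L S2, v <- L S1]) t x)).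
  apply: ler_sum_subset => [//||_ /mapP[w wF ->]].
    (* The pairs are distinct since concatenating the two parts recovers the class of the word. *)
    apply: (@map_uniq _ _ (fun x => trace_rep E (x.2 ++ x.1))); rewrite -map_comp.
    move: uF; congr uniq; apply/eq_in_map => w /gK /= e; exact: eq_trace_rep.
  by apply: allpairs_f; rewrite mem_undup map_f.
rewrite big_allpairs /= exprD invfM [_^-1 * _]mulrC mulrA.
apply: le_trans (ler_wpM2r _ (bd2 h _ (uL S2) (aL S2))); last by rewrite invr_ge0 exprn_ge0 ?ltW.
rewrite mulr_suml; apply: ler_sum => u _; rewrite -mulr_sumr -mulrA ler_wpM2l ?exprn_ge0 //.
exact: bd1 (uL S1) (aL S1).
Qed.

Lemma compl_component_join x (S : {set 'I_n}) : [disjoint compl_component E x & S] ->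
  {in compl_component E x & S, forall i j, E i j}.
Proof.
move=> dis i j iC jS; apply: contraT => nE; have : j \in compl_component E x.
  have := iC; rewrite !inE => /connect_trans; apply; apply: connect1.
  rewrite /compl_rel nE andbT; apply: contraTneq jS => <-.
  by rewrite (disjointFr dis).
by move=> /(disjointFr dis); rewrite jS.
Qed.

(** Induction on [#|S|], splitting off one component. Vertices of distinct components are adjacent,
    so the union of the two cliques is a clique whose size is the sum of theirs. *)
Lemma cauchy_bounded_closed (S : {set 'I_n}) :
  (forall x, x \in S -> compl_component E x \subset S) ->
  exists W : {set 'I_n}, [/\ W \subset S, is_clique E W & cauchy_bounded S #|W|].
Proof.
have [m] := ubnP #|S|; elim: m S => // m IHm S cS clS.
have [->|[x xS]] := set_0Vmem S.
  exists set0; rewrite sub0set cards0; split=> //; last exact: cauchy_bounded_set0.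
  by apply/cliqueP => i j; rewrite inE.
set C := compl_component E x.
have csym : connect_sym (compl_rel E).
  by apply: sym_connect_sym => i j; rewrite /compl_rel eq_sym Esym.
have xC : x \in C by rewrite inE connect0.
have SE : S = C :|: (S :\: C) by rewrite -{1}(setID S C) (setIidPr (clS x xS)).
have disC : [disjoint C & S :\: C] by rewrite disjoint_sym -setI_eq0 setIDAC -setIDA setDv setI0.
have [W1 [W1C clW1 bd1]] := cauchy_bounded_component x.
have [||W2 [W2S clW2 bd2]] := IHm (S :\: C).
- rewrite ltnS in cS; apply: leq_trans cS; apply: proper_card.
  by rewrite properE subsetDl; apply/subsetPn; exists x; rewrite // inE xC.
- move=> y; rewrite inE => /andP[yC yS]; apply/subsetP => z zy.
  rewrite inE (subsetP (clS y yS)) // andbT; apply: contra yC.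
  rewrite !inE in zy * => xz; apply: connect_trans xz _; by rewrite csym.
have E12 := compl_component_join disC.
have W12 : {in W1 & W2, forall i j, E i j}.
  by move=> i j iW jW; apply: E12; [apply: (subsetP W1C) | apply: (subsetP W2S)].
exists (W1 :|: W2); split.
- by rewrite SE setUSS.
- apply/cliqueP => i j; rewrite !inE => /orP[]iW /orP[]jW.
  + exact: (cliqueP _ _ clW1).
  + by rewrite W12.
  + by rewrite Esym W12.
  + exact: (cliqueP _ _ clW2).
rewrite SE cardsU disjoint_setI0 ?cards0 ?subn0; first exact: cauchy_bounded_join.
exact: disjointWl W1C (disjointWr W2S disC).
Qed.
End Hilbert.

(** * Passage to the full vertex set and the clique number *)

Theorem theorem4p4 (R : realType) (n : nat) (E : rel 'I_n)
    (Esym : forall j k : 'I_n, E j k = E k j) (Eirr : forall j : 'I_n, E j j = false)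
    (H : lmodType R[i]) (inner : H -> H -> R[i])
    (Hinner : is_inner_product inner) (Hcomplete : inner_complete inner)
    (T Ts : 'I_n -> {linear H -> H})
    (Hadj : forall (j : 'I_n) (x y : H), inner (T j x) y = inner x (Ts j y))
    (Hcontr : forall (j : 'I_n) (x : H), inner (T j x) (T j x) <= inner x x)
    (Hfam : Gamma_family E (fun j => T j))
    (Hbrehmer : weak_brehmer E (fun j => T j) (fun j => Ts j) inner)
    (r : R) (hr : 0 <= r < 1) (h : H) :
  forall F : seq (seq 'I_n),
    (forall k l : nat, (k < l < size F)%N ->
        ~ word_equiv E (nth [::] F k) (nth [::] F l)) ->
    cauchy_partial_sq (fun j => Ts j) inner r F h
      <= inner h h / (((1 - r ^+ 2) ^+ clique_number E)%:C)%C.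
Proof.
move=> F ineqF; have /andP[r0 r1] := hr.
pose s : R[i] := ((r ^+ 2)%:C)%C.
have s01 : 0 <= s < 1.
  by rewrite /s -(rmorph1 (real_complex R)) ler0c ltcR exprn_ge0 //= expr_lt1.
have [|W [_ clW bd]] := @cauchy_bounded_closed R n E Esym Eirr H inner Hinner
  (fun j => T j) (fun j => Ts j) Hadj Hfam Hbrehmer s s01 [set: 'I_n].
  by move=> x _; apply: subsetT.
have sE : (((1 - r ^+ 2) ^+ clique_number E)%:C)%C = (1 - s) ^+ clique_number E.
  by rewrite rmorphXn rmorphB rmorph1.
have /andP[s0 s1] := s01.
(* Since [#|W|] is at most the clique number and [0 < 1 - s <= 1], raising the exponent weakens the
   bound. *)
rewrite sE; apply: (@le_trans _ _ (inner h h / (1 - s) ^+ #|W|)); last first.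
  case: Hinner => _ _ pos _; rewrite ler_wpM2l ?pos // lef_pV2 ?posrE ?exprn_gt0 ?subr_gt0 //.
  apply: ler_wiXn2l; rewrite ?subr_ge0 ?(ltW s1) ?gerBl //.
  exact: (@leq_bigmax_cond _ _ (fun S : {set 'I_n} => #|S|)).
(* Reversing every word of [F] passes to the backwards reading. *)
have -> : cauchy_partial_sq (fun j => Ts j) inner r F h =
    \sum_(w <- map rev F) s ^+ size w *
      inner (word_op (fun j => Ts j) w h) (word_op (fun j => Ts j) w h).
  by rewrite big_map; apply: eq_bigr => w _; rewrite size_rev exprM rmorphXn.
apply: bd; last by apply/allP => w _; apply/allP => a _; rewrite inE.
rewrite -map_comp; apply/(uniqP [::]) => i j; rewrite !inE !size_map => iF jF.
(* Equal representatives of the reversed words would make the original words equivalent. *)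
have key k l : (k < l)%N -> (l < size F)%N ->
    trace_rep E (rev (nth [::] F k)) <> trace_rep E (rev (nth [::] F l)).
  move=> kl lF /(congr1 (trace_proj E)); rewrite !trace_repK => /trace_proj_rev.
  by move=> /(trace_proj_word_equiv Esym Eirr); apply: ineqF; rewrite kl.
rewrite !(nth_map [::]) //= => e; case: (ltngtP i j) => // ij.
  by have := key _ _ ij jF e.
by have := key _ _ ij iF (esym e).
Qed.
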